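(* Let $n\ge 2$, let $\mathcal{P}\subseteq\mathscr{B}(n)$ be an intersecting family of permutations and define $\mathcal{A}=\mathrm{ID}(\min(\mathcal{P}))$. Then $\mathcal{P}$ is maximum (i.e. has the largest cardinality among all intersecting families in $\mathscr{B}(n)$) if and only if $\mathcal{A}$ is a maximal intersecting antichain and $\mathcal{P}=\mathscr{P}(\mathcal{A})$.
   Context: $\mathscr{B}(n)=(\mathrm{Sym}(n),\preceq)$ is the (right) weak Bruhat lattice. A permutation is written $p=p_1p_2\cdots p_n$, meaning $p(i)=p_i$. The order $\preceq$ is generated by the covering relation: $q$ covers $p$ if, for some $i\in\{1,\dots,n-1\}$, $p_i<p_{i+1}$, $q_i=p_{i+1}$, $q_{i+1}=p_i$ and $q_k=p_k$ for all other $k$. The least element is the identity, and rank is distance from the identity. Let $g_i=(i,i+1)$ for $1\le i<n$ and $\mathbf{G}_n=\{g_1,\dots,g_{n-1}\}$. The inverse descent set of $p$ is $\mathrm{ID}(p)=\{g_i \mid i+1 \text{ precedes } i \text{ in } p_1p_2\cdots p_n\}$, and for a family $\mathcal{P}$, $\mathrm{ID}(\mathcal{P})=\{\mathrm{ID}(p)\mid p\in\mathcal{P}\}$. A family $\mathcal{P}\subseteq\mathscr{B}(n)$ is intersecting if $\mathrm{rank}(x\wedge y)\ge 1$ for all $x,y\in\mathcal{P}$ (including $x=y$). A system of sets is intersecting if $A\cap B\ne\emptyset$ for all members $A,B$ (including $A=B$). $\min(\mathcal{P})$ is the set of $\preceq$-minimal elements of $\mathcal{P}$. For $A\subseteq\mathbf{G}_n$,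 $\pi(A)=\bigvee_{g_i\in A}g_i$ (join in $\mathscr{B}(n)$). For a family $\mathcal{F}$, $\mathrm{up}(\mathcal{F})=\{z\mid x\preceq z\text{ for some }x\in\mathcal{F}\}$. For a system $\mathcal{A}$ of subsets of $\mathbf{G}_n$, $\mathscr{P}(\mathcal{A})=\mathrm{up}(\{\pi(A)\mid A\in\mathcal{A}\})$. A system $\mathcal{A}$ of subsets of $\mathbf{G}_n$ is a maximal intersecting antichain if it is intersecting, it is an antichain under inclusion, and for every $B\subseteq\mathbf{G}_n$ with $B\notin\mathcal{A}$ there is $A\in\mathcal{A}$ such that $A\cap B=\emptyset$ or $A\subseteq B$. *)

(* Defs.v *)
From HB Require Import structures.
From mathcomp Require Import all_boot all_order all_fingroup.
From mathcomp Require Import zify.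

Set Implicit Arguments.
Unset Strict Implicit.
Unset Printing Implicit Defensive.

Import Order.TTheory.

(* The word p_1 ... p_n of p : 'S_n is p 0, ..., p (n-1), with letters in      *)
(* {0, ..., n-1}; p^-1 a is the position of the letter a.                     *)

Definition weak_cover (n : nat) : rel 'S_n := fun p q =>
  [exists i : 'I_n, exists j : 'I_n,
    [&& j == i.+1 :> nat, p i < p j, q i == p j, q j == p i
      & [forall k : 'I_n, (k != i) ==> (k != j) ==> (q k == p k)]]].

Definition weak_le (n : nat) : rel 'S_n := connect (@weak_cover n).

(* The weak order is a lattice: it is inclusion of the sets of inverted pairs *)
(* of letters, and the sets of inversions of permutations are the transitive  *)
(* and cotransitive sets of pairs a < b.                                      *)

Definition invs (n : nat) (p : 'S_n) : {set 'I_n * 'I_n} :=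
  [set ab : 'I_n * 'I_n | (ab.1 < ab.2) && ((p^-1)%g ab.2 < (p^-1)%g ab.1)].

Lemma in_invs (n : nat) (p : 'S_n) (a b : 'I_n) :
  ((a, b) \in invs p) = (a < b) && ((p^-1)%g b < (p^-1)%g a).
Proof. by rewrite inE. Qed.

Lemma weak_coverP (n : nat) (p q : 'S_n) :
  reflect (exists i j : 'I_n,
             [/\ j = i.+1 :> nat, p i < p j & q = (tperm i j * p)%g])
          (weak_cover p q).
Proof.
apply: (iffP existsP) => [[i /existsP[j]] | [i [j [ji pij ->]]]].
  case/and5P=> /eqP ji pij /eqP qi /eqP qj /forallP qk.
  exists i, j; split=> //; apply/permP => k; rewrite permM.
  case: tpermP => [->|->|/eqP ki /eqP kj] //.
  by move: (qk k); rewrite ki kj => /eqP.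
exists i; apply/existsP; exists j; rewrite ji eqxx pij /=.
rewrite !permM tpermL tpermR !eqxx /=.
apply/forallP => k; apply/implyP => ki; apply/implyP => kj.
by rewrite permM tpermD // eq_sym.
Qed.

Lemma invs_tperm (n : nat) (p : 'S_n) (i j : 'I_n) :
  j = i.+1 :> nat -> p i < p j ->
  invs (tperm i j * p)%g = (p i, p j) |: invs p.
Proof.
move=> ji pij; apply/setP => -[a b]; rewrite in_setU1 !in_invs invMg tpermV.
rewrite !permM xpair_eqE.
have [u ->] : exists u, a = p u by exists ((p^-1)%g a); rewrite permKV.
have [v ->] : exists v, b = p v by exists ((p^-1)%g b); rewrite permKV.
rewrite !permK !(inj_eq perm_inj).
have neq (x y : 'I_n) : x <> y -> x <> y :> nat by move=> xy /val_inj.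
case: (tpermP i j v) => [->|->|/neq vi /neq vj];
  case: (tpermP i j u) => [->|->|/neq ui /neq uj]; rewrite -!val_eqE /=; lia.
Qed.

Lemma perm_mono_id (n : nat) (f : 'S_n) :
  (forall i j : 'I_n, j = i.+1 :> nat -> f i < f j) -> f = 1%g.
Proof.
move=> fS.
have fge m : forall i : 'I_n, i = m :> nat -> m <= f i.
  elim: m => [|m IHm] i im //.
  have mn : m < n by have := ltn_ord i; lia.
  have := fS (Ordinal mn) i im; have := IHm (Ordinal mn) erefl; lia.
have fle m : forall i : 'I_n, (i + m).+1 = n -> f i + m < n.
  elim: m => [|m IHm] i im; first by rewrite addn0.
  have mn : i.+1 < n by lia.
  have /= := fS i (Ordinal mn) erefl; have /= := IHm (Ordinal mn); lia.
apply/permP => i; rewrite perm1; apply: val_inj => /=.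
have := fge i i erefl; have := fle (n - i.+1) i; have := ltn_ord i; lia.
Qed.

Lemma invs_sub_neq (n : nat) (p q : 'S_n) :
  invs p \subset invs q -> p != q ->
  exists i j : 'I_n,
    [/\ j = i.+1 :> nat, p i < p j & (p i, p j) \in invs q].
Proof.
move=> /subsetP pq npq.
case: (boolP [exists i : 'I_n, exists j : 'I_n,
   [&& j == i.+1 :> nat, p i < p j & (p i, p j) \in invs q]]).
  by case/existsP => i /existsP[j /and3P[/eqP ? ? ?]]; exists i, j.
move=> H; case/eqP: npq; apply/eqP; rewrite eq_mulgV1; apply/eqP.
apply: perm_mono_id => i j ji; rewrite !permM.
have pne : p i <> p j :> nat.
  by move=> /val_inj /perm_inj ij; have := ltnn j; rewrite {2}ji ij ltnSn.
have qne : (q^-1)%g (p i) <> (q^-1)%g (p j) :> nat.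
  by move=> /val_inj /perm_inj /(congr1 val).
case: (ltngtP (p i) (p j)) => // pij.
  move: H; rewrite negb_exists => /forallP/(_ i).
  rewrite negb_exists => /forallP/(_ j); rewrite ji eqxx pij in_invs pij /=.
  by rewrite -leqNgt leq_eqVlt => /orP[/eqP/qne|].
by have := pq (p j, p i); rewrite !in_invs !permK pij ji ltnSn => /(_ isT).
Qed.

Lemma weak_leE (n : nat) (p q : 'S_n) : weak_le p q = (invs p \subset invs q).
Proof.
apply/idP/idP.
  case/connectP => s; elim: s p => [|r s IHs] p /= => [_ ->|/andP[pr rs] ls] //.
  apply: subset_trans (IHs _ rs ls); have [i [j [ji pij ->]]] := weak_coverP _ _ pr.
  by rewrite invs_tperm // subsetUr.
have [k] := ubnP #|invs q :\: invs p|; elim: k p => // k IHk p hk pq.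
have [->|npq] := eqVneq p q; first exact: connect0.
have [i [j [ji pij qij]]] := invs_sub_neq pq npq.
apply: (@connect_trans _ _ (tperm i j * p)%g).
  by apply: connect1; apply/weak_coverP; exists i, j.
apply: IHk; last by rewrite invs_tperm // subUset sub1set qij.
rewrite ltnS in hk; apply: leq_trans hk; apply: proper_card; rewrite invs_tperm //.
apply/properP; split; first by rewrite setDS // subsetUr.
exists (p i, p j); last by rewrite !inE eqxx.
by rewrite in_setD qij andbT in_invs !permK; lia.
Qed.

Lemma weak_le_refl (n : nat) : reflexive (@weak_le n).
Proof. by move=> p; apply: connect0. Qed.

Lemma weak_le_trans (n : nat) : transitive (@weak_le n).
Proof. by move=> q p r; apply: connect_trans. Qed.

Lemma weak_le_anti (n : nat) : antisymmetric (@weak_le n).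
Proof.
move=> p q; rewrite !weak_leE => /andP[pq /subsetP qp]; apply/eqP.
apply: contraT => npq; have [i [j [ji pij /qp]]] := invs_sub_neq pq npq.
by rewrite in_invs !permK; lia.
Qed.

Lemma invs1 (n : nat) : invs (1%g : 'S_n) = set0.
Proof. by apply/setP => -[a b]; rewrite in_invs invg1 !perm1 inE; lia. Qed.

Lemma weak_le1 (n : nat) (p : 'S_n) : weak_le 1%g p.
Proof. by rewrite weak_leE invs1 sub0set. Qed.

Lemma invs_realize (n : nat) (I : rel 'I_n) :
  (forall a b, I a b -> a < b) -> transitive I ->
  (forall a b c : 'I_n, a < b -> b < c -> I a c -> I a b || I b c) ->
  exists p : 'S_n, invs p == [set ab : 'I_n * 'I_n | I ab.1 ab.2].
Proof.
move=> Ilt Itr Ico.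
pose before (x y : 'I_n) := (x < y) && ~~ I x y || (y < x) && I y x.
have btr : transitive before.
  move=> y x z; rewrite /before.
  have Tr (a b c : 'I_n) := @Itr b a c.
  move: (Tr x y z) (Tr x z y) (Tr y x z) (Tr y z x) (Tr z x y) (Tr z y x).
  move: (Ico x y z) (Ico x z y) (Ico y x z) (Ico y z x) (Ico z x y) (Ico z y x).
  case xz: (x == z); first by rewrite (eqP xz); case: (ltngtP z y); case: (I z y); case: (I y z).
  move: xz; rewrite -val_eqE /=.
  case: (ltngtP x y) => //= ?; case: (ltngtP y z) => //= ?; case: (ltngtP x z) => //= ?; try lia;
  case: (I x y); case: (I y x); case: (I x z); case: (I z x);
  case: (I y z); case: (I z y) => //=; try lia; intuition.
have btot x y : x != y -> before x y = ~~ before y x.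
  by rewrite /before -val_eqE /=; case: ltngtP => //= _ _; rewrite ?orbF ?negbK.
have birr x : before x x = false by rewrite /before ltnn.
pose r x := #|[set y | before y x]|.
have rlt x : r x < n.
  rewrite -[X in _ < X]card_ord -cardsT; apply: proper_card; apply/properP.
  by split; [apply: subsetT | exists x; rewrite ?inE ?birr].
have rmono x y : before x y -> r x < r y.
  move=> xy; apply: proper_card; apply/properP; split.
    by apply/subsetP => z; rewrite !inE => zx; apply: btr zx xy.
  by exists x; rewrite ?inE ?birr.
have rmonoE x y : (r x < r y) = before x y.
  apply/idP/idP => [|/rmono //]; have [->|/btot E] := eqVneq x y; first by rewrite ltnn.
  by rewrite E => rxy; apply/negP => /rmono; lia.
have finj : injective (fun x => Ordinal (rlt x)).
  move=> x y /(congr1 val) /= E; apply: contraTeq isT => xy.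
  by have := btot _ _ xy; rewrite -!rmonoE E ltnn.
exists ((perm finj)^-1)%g; apply/eqP/setP => -[a b]; rewrite in_invs invgK !permE /=.
rewrite rmonoE inE /= /before; apply/idP/idP => [|Iab]; last by rewrite Ilt // Iab orbT.
by case/andP=> ab; rewrite ab (ltnNge b) ltnW.
Qed.

Definition inv_union (n : nat) (S : pred 'S_n) : rel 'I_n :=
  fun a b => [exists p, S p && ((a, b) \in invs p)].

Lemma weak_lub_subproof (n : nat) (S : pred 'S_n) :
  exists p : 'S_n,
    invs p == [set ab : 'I_n * 'I_n | (ab.1 < ab.2) && connect (inv_union S) ab.1 ab.2].
Proof.
have Ult a b : inv_union S a b -> a < b.
  by case/existsP => p /andP[_]; rewrite in_invs => /andP[].
have Ule (a b : 'I_n) : connect (inv_union S) a b -> a <= b.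
  case/connectP => s; elim: s a => [|c s IHs] a /= => [_ ->|/andP[ac cs] ls] //.
  exact: leq_trans (ltnW (Ult _ _ ac)) (IHs _ cs ls).
apply: (@invs_realize _ (fun a b => (a < b) && connect (inv_union S) a b)).
- by move=> a b /andP[].
- move=> b a c /andP[ab Cab] /andP[bc Cbc].
  by rewrite (ltn_trans ab bc) (connect_trans Cab Cbc).
move=> a b c ab bc; rewrite ab bc /= => /andP[_ /connectP[s]].
elim: s a ab => [|d s IHs] a ab /= => [_ E|/andP[ad ds] ls].
  by move: (ltn_trans ab bc); rewrite E ltnn.
have Cdc : connect (inv_union S) d c by apply/connectP; exists s.
case: (ltngtP d b) => [db|bd|/val_inj <-]; last by rewrite connect1.
  by case/orP: (IHs _ db ds ls) => [Cdb|->]; rewrite ?orbT // (connect_trans (connect1 ad)).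
case/existsP: ad => p /andP[Sp]; rewrite in_invs => /andP[_ pad].
case: (ltngtP ((p^-1)%g b) ((p^-1)%g a)) => [pb|pb|].
- apply/orP; left; apply: connect1; apply/existsP; exists p.
  by rewrite Sp in_invs ab.
- apply/orP; right; apply: connect_trans Cdc; apply: connect1; apply/existsP.
  by exists p; rewrite Sp in_invs bd; apply: ltn_trans pb.
by move/val_inj/perm_inj=> E; move: ab; rewrite E ltnn.
Qed.

Definition weak_lub (n : nat) (S : pred 'S_n) : 'S_n :=
  xchoose (weak_lub_subproof S).

Lemma weak_lubP (n : nat) (S : pred 'S_n) (z : 'S_n) :
  reflect (forall p, S p -> weak_le p z) (weak_le (weak_lub S) z).
Proof.
rewrite weak_leE (eqP (xchooseP (weak_lub_subproof S))).
apply: (iffP subsetP) => [H p Sp | H [a b]].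
  rewrite weak_leE; apply/subsetP => -[a b] pab; apply: H; rewrite inE /=.
  move: (pab); rewrite in_invs => /andP[-> _] /=.
  by apply: connect1; apply/existsP; exists p; rewrite Sp.
rewrite inE /= => /andP[ab /connectP[s]].
elim: s a ab => [|c s IHs] a ab /= => [_ E|/andP[ac cs] ls].
  by move: ab; rewrite E ltnn.
have : (a, c) \in invs z.
  case/existsP: ac => p /andP[/H]; rewrite weak_leE => /subsetP; exact.
have [-> //|cb] := eqVneq c b.
rewrite !in_invs => /andP[a_c zac]; rewrite ab /=.
have c_b : c < b.
  have : connect (inv_union S) c b by apply/connectP; exists s.
  rewrite -val_eqE /= in cb; rewrite ltn_neqAle cb /=.
  case/connectP => t; elim: t (c) => [|d t IHt] e /= => [_ ->|/andP[ed dt] lt] //.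
  apply: leq_trans (IHt _ dt lt); apply: ltnW.
  by case/existsP: ed => p /andP[_]; rewrite in_invs => /andP[].
by have := IHs _ c_b cs ls; rewrite in_invs => /andP[_ zcb]; apply: ltn_trans zac.
Qed.

Definition weak_join (n : nat) (p q : 'S_n) : 'S_n := weak_lub (pred2 p q).

Definition weak_meet (n : nat) (p q : 'S_n) : 'S_n :=
  weak_lub [pred z | weak_le z p && weak_le z q].

Lemma weak_joinP (n : nat) (p q z : 'S_n) :
  weak_le (weak_join p q) z = weak_le p z && weak_le q z.
Proof.
apply/weak_lubP/andP => [H|[pz qz] x /orP[]/eqP-> //].
by split; apply: H; rewrite /= eqxx ?orbT.
Qed.

Lemma weak_meetP (n : nat) (z p q : 'S_n) :
  weak_le z (weak_meet p q) = weak_le z p && weak_le z q.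
Proof.
apply/idP/idP => [zm|zpq].
  by rewrite !(weak_le_trans zm) //; apply/weak_lubP => x /andP[].
have /weak_lubP : weak_le (weak_meet p q) (weak_meet p q) by apply: weak_le_refl.
exact.
Qed.

Lemma weak_le_top (n : nat) (p : 'S_n) : weak_le p (weak_lub predT).
Proof.
have /weak_lubP : weak_le (weak_lub (@predT 'S_n)) (weak_lub predT).
  exact: weak_le_refl.
exact.
Qed.

(* A copy of 'S_n carrying the weak order, so that no order is declared on    *)
(* permutations globally.                                                     *)
Definition bruhat (n : nat) : Type := 'S_n.

Fact bruhat_display : Order.disp_t. Proof. exact: Order.Disp tt tt. Qed.

HB.instance Definition _ (n : nat) := Finite.copy (bruhat n) 'S_n.
HB.instance Definition _ (n : nat) :=
  Order.Le_isPOrder.Build bruhat_display (bruhat n)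
    (@weak_le_refl n) (@weak_le_anti n) (@weak_le_trans n).
HB.instance Definition _ (n : nat) :=
  Order.POrder_MeetJoin_isLattice.Build bruhat_display (bruhat n)
    (@weak_meetP n) (fun p q z => @weak_joinP n p q z).
HB.instance Definition _ (n : nat) :=
  Order.hasBottom.Build bruhat_display (bruhat n) (@weak_le1 n).
HB.instance Definition _ (n : nat) :=
  Order.hasTop.Build bruhat_display (bruhat n) (@weak_le_top n).

(* The distance from 1 in the Hasse diagram, measured along ascending cover   *)
(* chains; the weak order is graded, so descending steps cannot shorten it.   *)
Lemma bruhat_rank_subproof (n : nat) (p : bruhat n) :
  exists k, [exists s : k.-tuple 'S_n,
               path (@weak_cover n) 1%g s && (last 1%g s == p)].
Proof.
case/connectP: (weak_le1 p) => s ps ->; exists (size s).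
by apply/existsP; exists (in_tuple s); rewrite ps eqxx.
Qed.

Definition rank (n : nat) (p : bruhat n) : nat := ex_minn (bruhat_rank_subproof p).

Definition generators (n : nat) : {set bruhat n} :=
  [set tperm ij.1 ij.2 | ij : 'I_n * 'I_n & ij.2 == ij.1.+1 :> nat].

Definition inv_descents (n : nat) (p : bruhat n) : {set bruhat n} :=
  [set tperm ij.1 ij.2 | ij : 'I_n * 'I_n
     & (ij.2 == ij.1.+1 :> nat) && ((p^-1)%g ij.2 < (p^-1)%g ij.1)].

Definition inv_descent_system (n : nat) (P : {set bruhat n}) :
  {set {set bruhat n}} := [set inv_descents p | p in P].

Definition intersecting_family (n : nat) (P : {set bruhat n}) : Prop :=
  forall x y : bruhat n, x \in P -> y \in P -> 1 <= rank (x `&` y)%O.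

Definition maximum_family (n : nat) (P : {set bruhat n}) : Prop :=
  intersecting_family P /\
  forall Q : {set bruhat n}, intersecting_family Q -> #|Q| <= #|P|.

Definition minimal_elements (n : nat) (P : {set bruhat n}) : {set bruhat n} :=
  [set p in P | [forall q in P, (q <= p)%O ==> (q == p)]].

Definition join_of (n : nat) (A : {set bruhat n}) : bruhat n :=
  (\join_(g in A) g)%O.

Definition up (n : nat) (F : {set bruhat n}) : {set bruhat n} :=
  [set z | [exists x in F, (x <= z)%O]].

Definition generated_family (n : nat) (A : {set {set bruhat n}}) :
  {set bruhat n} := up [set join_of X | X in A].

Definition intersecting_system (n : nat) (A : {set {set bruhat n}}) : Prop :=
  forall X Y : {set bruhat n}, X \in A -> Y \in A -> X :&: Y != set0.

Definition antichain (n : nat) (A : {set {set bruhat n}}) : Prop :=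
  forall X Y : {set bruhat n}, X \in A -> Y \in A -> X \subset Y -> X = Y.

Definition maximal_intersecting_antichain (n : nat)
    (A : {set {set bruhat n}}) : Prop :=
  [/\ forall X : {set bruhat n}, X \in A -> X \subset generators n,
      intersecting_system A,
      antichain A
    & forall B : {set bruhat n}, B \subset generators n -> B \notin A ->
        exists2 X, X \in A & X :&: B = set0 \/ X \subset B].

(* Main.v *)
Require Import Defs.
From mathcomp Require Import all_boot all_order all_fingroup.
From mathcomp Require Import zify.

(* The atoms of the weak order are the generators, and ID(p) is the set of    *)
(* atoms below p; hence a family is intersecting iff its inverse descent sets *)
(* pairwise meet. Reversing words complements ID, so an intersecting family   *)
(* contains at most one word of each pair {p, reverse of p}. If A is a        *)
(* maximal intersecting antichain, P(A) contains at least one word of each    *)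
(* pair, so it is maximum. Conversely, a maximum P contains every z such that *)
(* ID(z) includes ID(x) for some x in P; since ID(pi(B)) = B, its minimal     *)
(* elements are joins of atoms and P is determined by their ID.               *)

Set Implicit Arguments.
Unset Strict Implicit.
Unset Printing Implicit Defensive.

Import Order.TTheory.

(** Being intersecting depends only on inverse descent sets ([intersecting_familyP]), and an
    intersecting family has size at most half of ['S_n] ([intersecting_card]), a bound that
    [generated_family_card] shows is reached by every maximal intersecting antichain. For the
    converse, maximality alone is used: a permutation whose set meets those of all members already
    belongs to the family ([maximum_family_mem]). Applied to joins of atoms, this identifies the
    minimal elements and shows that no set can be added to the antichain. *)

Section WeakOrder.

Variable n : nat.
Implicit Types (x y z g : bruhat n) (A B X : {set bruhat n}).
Implicit Types P Q : {set bruhat n}.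

(** * Inverse descents as atoms of the weak order *)

Lemma bruhat_leE x y : (x <= y)%O = (invs x \subset invs y).
Proof. by rewrite -weak_leE. Qed.

Lemma generatorsP g :
  reflect (exists i j : 'I_n, j = i.+1 :> nat /\ g = tperm i j)
          (g \in generators n).
Proof.
apply: (iffP imsetP) => [[[i j]]|[i [j [ij ->]]]].
  by rewrite inE /= => /eqP ij ->; exists i, j.
by exists (i, j); rewrite ?inE /= ?ij.
Qed.

Lemma invs_generator (i j : 'I_n) :
  j = i.+1 :> nat -> invs (tperm i j) = [set (i, j)].
Proof.
move=> ij; rewrite -[tperm i j]mulg1 invs_tperm ?perm1 //; last by rewrite ij.
by rewrite invs1 setU0.
Qed.

Lemma generator_le (i j : 'I_n) x : j = i.+1 :> nat ->
  ((tperm i j : bruhat n) <= x)%O = ((x^-1)%g j < (x^-1)%g i).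
Proof.
by move=> ij; rewrite bruhat_leE invs_generator // sub1set in_invs ij ltnSn.
Qed.

Lemma inv_descentsE x : inv_descents x = [set g in generators n | (g <= x)%O].
Proof.
apply/setP => g; rewrite inE; apply/imsetP/andP => [[[i j]]|].
  rewrite inE /= => /andP[/eqP ij xij] ->; split; last by rewrite generator_le.
  by apply/generatorsP; exists i, j.
case=> /generatorsP[i [j [ij ->]]]; rewrite generator_le // => xij.
by exists (i, j); rewrite // inE /= ij eqxx.
Qed.

Lemma inv_descents_sub x : inv_descents x \subset generators n.
Proof. by rewrite inv_descentsE setIdE subsetIl. Qed.

Lemma le_inv_descents x y :
  (x <= y)%O -> inv_descents x \subset inv_descents y.
Proof.
move=> xy; apply/subsetP => g; rewrite !inv_descentsE !inE => /andP[-> gx] /=.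
exact: le_trans gx xy.
Qed.

Lemma inv_descents_generator g :
  g \in generators n -> inv_descents g = [set g].
Proof.
move=> Gg; apply/setP => h; rewrite inv_descentsE !inE.
apply/andP/eqP => [[]|-> //]; move: Gg.
case/generatorsP=> i [j [ij ->]] /generatorsP[k [l [kl ->]]].
by rewrite bruhat_leE !invs_generator // sub1set inE => /eqP[-> ->].
Qed.

Lemma rank_gt0 z : (0 < rank z) = (z != 1%g).
Proof.
rewrite lt0n; congr (~~ _); apply/idP/idP => [/eqP|/eqP ->].
  rewrite /rank; case: ex_minnP => k /existsP[s /andP[_ /eqP sz]] _ k0.
  by move: s sz; rewrite k0 => s; rewrite (tuple0 s) /= => ->.
rewrite /rank; case: ex_minnP => k _ /(_ 0); rewrite leqn0; apply.
by apply/existsP; exists [tuple]; rewrite /= eqxx.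
Qed.

(** Every nontrivial [z] lies above an atom: [invs_sub_neq] at the identity gives an inverted pair
    of consecutive letters. *)
Lemma inv_descents_eq0 z : (inv_descents z == set0) = (z == 1%g).
Proof.
apply/eqP/eqP => [z0|->]; last first.
  apply/setP => g; rewrite inv_descentsE !inE; apply/negP => /andP[].
  case/generatorsP=> i [j [ij ->]].
  by rewrite bruhat_leE invs_generator // invs1 sub1set inE.
apply/eqP; apply: contraT; rewrite eq_sym => z1.
have [|i [j [ij _ zij]]] := @invs_sub_neq _ 1%g z _ z1.
  by rewrite invs1 sub0set.
suff: tperm i j \in inv_descents z by rewrite z0 inE.
rewrite inv_descentsE inE bruhat_leE invs_generator // sub1set.
rewrite !perm1 in zij; rewrite zij andbT; apply/generatorsP; by exists i, j.
Qed.

Lemma inv_descents_meet x y :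
  inv_descents (x `&` y)%O = inv_descents x :&: inv_descents y.
Proof.
apply/setP => g; rewrite !inv_descentsE !inE lexI.
by case: (g \in generators n).
Qed.

(** Positive rank means that the meet is not the identity, hence lies above an atom; the atoms below
    a meet are the common ones. *)
Lemma intersecting_familyP P :
  intersecting_family P <->
  {in P &, forall x y, inv_descents x :&: inv_descents y != set0}.
Proof.
split=> IP x y Px Py; have := IP x y Px Py;
  by rewrite rank_gt0 -inv_descents_meet inv_descents_eq0.
Qed.

(** * Reversal of words *)

Definition word_rev x : bruhat n := (perm (@rev_ord_inj n) * x)%g.

Lemma word_rev_inj : injective word_rev.
Proof. exact: mulgI. Qed.

(** The left factor of a product acts first, so [word_rev] reverses positions and keeps letters;
    hence it swaps which of two consecutive letters comes first. *)
Lemma inv_descents_rev x :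
  inv_descents (word_rev x) = generators n :\: inv_descents x.
Proof.
apply/setP => g; rewrite inE !inv_descentsE !inE andbC.
case Gg: (g \in generators n); rewrite ?andbF //= !andbT.
case/generatorsP: Gg => i [j [ij ->]]; rewrite !generator_le //.
have revV : ((perm (@rev_ord_inj n))^-1)%g = perm (@rev_ord_inj n).
  by apply/permP => k; apply: (@perm_inj _ (perm (@rev_ord_inj n)));
     rewrite permKV !permE rev_ordK.
rewrite invMg !permM revV !(permE (@rev_ord_inj n)) /= -leqNgt.
have : (x^-1)%g i != (x^-1)%g j :> nat.
  by apply/eqP => /val_inj/perm_inj/(congr1 val) /=; lia.
have := ltn_ord ((x^-1)%g i); have := ltn_ord ((x^-1)%g j).
by move: (nat_of_ord _) (nat_of_ord _) => b a; lia.
Qed.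

(** * Joins of atoms *)

Lemma join_of_leP A z :
  reflect {in A, forall g, (g <= z)%O} (join_of A <= z)%O.
Proof. exact: joinsP. Qed.

Lemma join_of_le A x :
  A \subset generators n -> (join_of A <= x)%O = (A \subset inv_descents x).
Proof.
move=> AG; rewrite inv_descentsE; apply/join_of_leP/subsetP => H g Ag.
  by rewrite inE (subsetP AG) //= H.
by have := H g Ag; rewrite inE => /andP[].
Qed.

(* The reverse of g lies above every generator except g. *)
Lemma inv_descents_join A :
  A \subset generators n -> inv_descents (join_of A) = A.
Proof.
move=> AG; apply/eqP; rewrite eqEsubset -join_of_le // lexx andbT.
apply/subsetP => g Dg; have Gg := subsetP (inv_descents_sub _) g Dg.
apply: contraT => Ag; suff /le_inv_descents/subsetP/(_ g Dg) :
    (join_of A <= word_rev g)%O.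
  by rewrite inv_descents_rev inv_descents_generator // !inE eqxx.
rewrite join_of_le // inv_descents_rev inv_descents_generator //.
by rewrite subsetD AG disjoint_sym disjoints1.
Qed.

Lemma join_inv_descents_le x : (join_of (inv_descents x) <= x)%O.
Proof. by rewrite join_of_le ?inv_descents_sub. Qed.

(** * Generated families and the two half-size bounds *)

Lemma generated_familyP (S : {set {set bruhat n}}) z :
  {in S, forall X, X \subset generators n} ->
  reflect (exists2 X, X \in S & X \subset inv_descents z)
          (z \in generated_family S).
Proof.
move=> SG; rewrite inE; apply: (iffP existsP) => [[x]|[X SX Xz]].
  case/andP=> /imsetP[X SX ->] Xz; exists X => //.
  by rewrite -join_of_le ?SG.
by exists (join_of X); rewrite imset_f //= join_of_le ?SG.
Qed.

(** [Q] is disjoint from its image under reversal, because a set never meets its complement. *)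
Lemma intersecting_card Q :
  intersecting_family Q -> #|Q| * 2 <= #|[set: bruhat n]|.
Proof.
move=> /intersecting_familyP IQ; rewrite muln2 -addnn.
rewrite -{2}(card_imset _ word_rev_inj) -cardsUI.
suff -> : Q :&: [set word_rev x | x in Q] = set0.
  by rewrite cards0 addn0 subset_leq_card // subsetT.
apply/eqP; rewrite -subset0; apply/subsetP => z /setIP[Qz /imsetP[x Qx zx]].
have := IQ z x Qz Qx; rewrite zx inv_descents_rev setDE -setIA.
by rewrite [_ :&: inv_descents x]setIC setICr setI0 eqxx.
Qed.

Lemma generated_family_card (S : {set {set bruhat n}}) :
  maximal_intersecting_antichain S ->
  #|[set: bruhat n]| <= #|generated_family S| * 2.
Proof.
move=> [SG _ _ Smax].
rewrite muln2 -addnn.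
rewrite -{1}(card_preimset (generated_family S) word_rev_inj) addnC.
rewrite -cardsUI; apply: leq_trans (leq_addr _ _).
apply: subset_leq_card; apply/subsetP => z _.
rewrite in_setU [z \in _ @^-1: _]inE.
have [Sz|Sz] := boolP (inv_descents z \in S).
  by apply/orP; left; apply/generated_familyP => //; exists (inv_descents z).
(* A member [X] inside the set of [z] puts [z] in the family; one disjoint from it lies in the
   complement, which puts the reverse of [z] there. *)
have [X SX [Xz|Xz]] := Smax _ (inv_descents_sub z) Sz; apply/orP; last first.
  by left; apply/generated_familyP => //; exists X.
right; apply/generated_familyP => //; exists X => //.
by rewrite inv_descents_rev subsetD SG //= -setI_eq0 Xz.
Qed.

(** * Structure of maximum families *)

Lemma minimal_element_exists P z :
  z \in P -> exists2 x, x \in minimal_elements P & (x <= z)%O.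
Proof.
move=> Pz; pose C x := (x \in P) && (x <= z)%O.
have Cz : C z by rewrite /C Pz lexx.
case: (arg_minnP (fun x => #|invs x|) Cz) => x /andP[Px xz] xmin.
exists x => //.
rewrite inE Px; apply/forallP => q; apply/implyP => Pq; apply/implyP => qx.
have := xmin q; rewrite /C Pq (le_trans qx xz) => /(_ isT) card_xq.
rewrite eq_le qx bruhat_leE; move: qx; rewrite bruhat_leE => qx.
have /eqP <- : invs q == invs x by rewrite eqEcard qx.
by rewrite subxx.
Qed.

(** Otherwise [z |: P] would be a larger intersecting family. *)
Lemma maximum_family_mem P z : maximum_family P -> inv_descents z != set0 ->
  {in P, forall x, inv_descents x :&: inv_descents z != set0} -> z \in P.
Proof.
move=> [/intersecting_familyP IP Pmax] z0 Pz; apply: contraT => zP.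
have /Pmax : intersecting_family (z |: P).
  apply/intersecting_familyP => x y /setU1P[->|Px] /setU1P[->|Py].
  - by rewrite setIid.
  - by rewrite setIC Pz.
  - exact: Pz.
  - exact: IP.
by rewrite cardsU1 zP add1n ltnn.
Qed.

Lemma maximum_family_closed P x z : maximum_family P -> x \in P ->
  inv_descents x \subset inv_descents z -> z \in P.
Proof.
move=> maxP Px xz; have /intersecting_familyP IP := maxP.1.
apply: maximum_family_mem => // [|y Py].
  by have := IP x x Px Px; rewrite setIid; apply: subset_neq0.
by have := IP y x Py Px; apply: subset_neq0; apply: setIS.
Qed.

Lemma maximum_family_neq0 P : 2 <= n -> maximum_family P -> P != set0.
Proof.
move=> n2 [_ Pmax]; have n0 : 0 < n by lia.
pose g : bruhat n := tperm (Ordinal n0) (Ordinal n2).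
have Gg : g \in generators n.
  by apply/generatorsP; exists (Ordinal n0), (Ordinal n2).
have /Pmax : intersecting_family [set g].
  apply/intersecting_familyP => x y /set1P -> /set1P ->.
  by rewrite setIid inv_descents_generator // -cards_eq0 cards1.
by rewrite cards1 card_gt0.
Qed.

Lemma minimal_in P x : x \in minimal_elements P -> x \in P.
Proof. by rewrite inE => /andP[]. Qed.

Lemma minimal_eq P x y :
  x \in minimal_elements P -> y \in P -> (y <= x)%O -> y = x.
Proof.
by rewrite inE => /andP[_ /forallP/(_ y)/implyP H] /H/implyP {}H /H/eqP.
Qed.

(** The join has the same inverse descents as [x], so it is in [P] by closure; it lies below [x],
    which is minimal. *)
Lemma maximum_family_minimal P x : maximum_family P ->
  x \in minimal_elements P -> join_of (inv_descents x) = x.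
Proof.
move=> maxP minx; apply: minimal_eq (minx) _ (join_inv_descents_le x).
apply: maximum_family_closed (minimal_in minx) _ => //.
by rewrite inv_descents_join ?inv_descents_sub.
Qed.

Lemma inv_descent_system_sub P X :
  X \in inv_descent_system P -> X \subset generators n.
Proof. by case/imsetP=> x _ ->; apply: inv_descents_sub. Qed.

Lemma maximum_family_generated P : maximum_family P ->
  P = generated_family (inv_descent_system (minimal_elements P)).
Proof.
move=> maxP; apply/setP => z; apply/idP/generated_familyP => [|Pz|].
- exact: inv_descent_system_sub.
- have [x minx xz] := minimal_element_exists Pz.
  by exists (inv_descents x); [apply: imset_f | apply: le_inv_descents].
case=> _ /imsetP[x minx ->]; exact: maximum_family_closed (minimal_in minx).
Qed.

Lemma maximum_family_antichain P : 2 <= n -> maximum_family P ->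
  maximal_intersecting_antichain (inv_descent_system (minimal_elements P)).
Proof.
move=> n2 maxP; have /intersecting_familyP IP := maxP.1; split.
- exact: inv_descent_system_sub.
- move=> _ _ /imsetP[x minx ->] /imsetP[y miny ->].
  exact: IP (minimal_in minx) (minimal_in miny).
- move=> _ _ /imsetP[x minx ->] /imsetP[y miny ->] xy; congr inv_descents.
  apply: minimal_eq miny (minimal_in minx) _.
  (* As [x] is the join of its atoms, inclusion of the sets gives [x] below [y]. *)
  by rewrite -(maximum_family_minimal maxP minx) join_of_le ?inv_descents_sub.
move=> B BG _; set S := inv_descent_system _.
have [/existsP[X /andP[SX /eqP XB]]|noX] :=
  boolP [exists X, (X \in S) && (X :&: B == set0)].
  by exists X; [|left].
have meetB X : X \in S -> X :&: B != set0.
  by move=> SX; apply: contra noX => XB; apply/existsP; exists X; rewrite SX.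
have PB x : x \in P -> inv_descents x :&: B != set0.
  move=> /minimal_element_exists[y miny yx].
  have := meetB _ (imset_f _ miny).
  by apply: subset_neq0; apply/setSI/le_inv_descents.
(* A member of [P] is needed to see that [B], which meets its set, is nonempty. *)
have /set0Pn[x Px] := maximum_family_neq0 n2 maxP.
have : join_of B \in P.
  apply: maximum_family_mem; rewrite ?inv_descents_join //.
  by apply: subset_neq0 (PB x Px); apply: subsetIr.
(* Now [join_of B], whose set is [B], lies in the generated family, so some member of [S] is
   contained in [B]. *)
rewrite {1}(maximum_family_generated maxP).
case/generated_familyP=> [|X SX]; first exact: inv_descent_system_sub.
by rewrite inv_descents_join // => XB; exists X; [|right].
Qed.

End WeakOrder.

Theorem theorem4p10 (n : nat) (P : {set bruhat n}) :
  2 <= n -> intersecting_family P ->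
  let A := inv_descent_system (minimal_elements P) in
  maximum_family P <->
  maximal_intersecting_antichain A /\ P = generated_family A.
Proof.
move=> n2 IP A; split=> [maxP|[maxA PA]].
  by split; [apply: maximum_family_antichain | apply: maximum_family_generated].
split=> // Q /intersecting_card cardQ.
(* Both sides are compared with half the number of permutations. *)
rewrite -(@leq_pmul2r 2) //; apply: leq_trans cardQ _.
by rewrite {1}PA; apply: generated_family_card.
Qed.
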